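(* Let $A_C\in\mathbb{R}^{n\times n}$ be a companion matrix with distinct eigenvalues $\lambda_1,\dots,\lambda_m$ of algebraic multiplicities $n_1,\dots,n_m$ ($n_1+\dots+n_m=n$), satisfying $\lambda_i+\lambda_j\neq 0$ for all $i,j$. Let $P_C(\infty)$ be the solution of $A_CP+PA_C^T=-e_ne_n^T$, and let $P_C^{-1}(\infty)$ be its inverse, which satisfies the algebraic Riccati equation $P^{-1}A_C+A_C^TP^{-1}=-P^{-1}e_ne_n^TP^{-1}$. Then $$P_C(\infty)=\sum_{i=1}^m\hat P_i^C,\qquad P_C^{-1}(\infty)=\sum_{j=1}^m\hat P_j^{-C},$$ $$\hat P_i^C=M_i\mathcal{H}_i\mathcal{T}_i^{-1}M_i^T\mathcal{J},\qquad \hat P_j^{-C}=\mathcal{J}(M_j^{(-1)})^T\mathcal{T}_j\mathcal{H}_j^{-1}M_j^{(-1)},$$ where $\mathcal{T}_i$ and $\mathcal{H}_i$ are the $n_i\times n_i$ lower triangular Toeplitz and upper Hankel matrices $$\mathcal{T}_i=\begin{bmatrix} c^Tx_1^{(i)} & 0 & \cdots & 0 \\ c^Tx_2^{(i)} & c^Tx_1^{(i)} & \ddots & \vdots \\ \vdots & \ddots & \ddots & 0 \\ c^Tx_{n_i}^{(i)} & \cdots & c^Tx_2^{(i)} & c^Tx_1^{(i)} \end{bmatrix},\qquad \mathcal{H}_i=\begin{bmatrix} e_n^Ty_1^{(i)} & e_n^Ty_2^{(i)} & \cdots & e_n^Ty_{n_i}^{(i)} \\ e_n^Ty_2^{(i)}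 & \cdots & e_n^Ty_{n_i}^{(i)} & 0 \\ \vdots & & & \vdots \\ e_n^Ty_{n_i}^{(i)} & 0 & \cdots & 0 \end{bmatrix}$$ (that is, $(\mathcal{T}_i)_{kl}=c^Tx^{(i)}_{k-l+1}$ for $k\ge l$ and $0$ otherwise; $(\mathcal{H}_i)_{kl}=e_n^Ty^{(i)}_{k+l-1}$ for $k+l-1\le n_i$ and $0$ otherwise), with $$c^T=a^T\left((-1)^nI+\mathcal{J}\right),\qquad a^T=[a_0,a_1,\dots,a_{n-1}].$$ Moreover, $\hat P_i^C\hat P_j^{-C}=\delta_{ij}M_iM_i^{(-1)}$ for all $i,j$.
   Context: The companion matrix is $A_C=\begin{bmatrix} 0_{(n-1)\times 1} & I_{(n-1)\times(n-1)} \\ -a_0 & -a_1\ \cdots\ -a_{n-1} \end{bmatrix}$ with real $a_0,\dots,a_{n-1}$, so $\det(sI-A_C)=s^n+\sum_{k=0}^{n-1}a_ks^k$; $e_n=[0,\dots,0,1]^T$. $\mathcal{J}=\mathrm{diag}(-1,(-1)^2,\dots,(-1)^n)$. Write a Jordan normal form $A_C=MJM^{-1}$, $J=J_1\oplus\dots\oplus J_m$ with one Jordan block $J_i$ of size $n_i$ for each $\lambda_i$ (as is the case for a companion matrix). The columns of $M=[M_1,\dots,M_m]$, $M_i=[x_1^{(i)},\dots,x_{n_i}^{(i)}]$, are generalized right eigenvectors forming Jordan chains: $(A_C-\lambda_iI)x_1^{(i)}=0$, $(A_C-\lambda_iI)x_{k}^{(i)}=x_{k-1}^{(i)}$ for $2\le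 k\le n_i$. The rows of $M^{-1}$ are the generalized left eigenvectors: $M^{-1}$ is the vertical stacking of $M_1^{(-1)},\dots,M_m^{(-1)}$, where $M_i^{(-1)}=[y_1^{(i)},\dots,y_{n_i}^{(i)}]^T$ is $n_i\times n$, so that $(y_l^{(j)})^Tx_k^{(i)}=\delta_{ij}\delta_{kl}$ and $M_i^{(-1)}M_j=\delta_{ij}I_{n_i\times n_i}$. Any choice of such Jordan chains is allowed. $\delta_{ij}$ is the Kronecker symbol. Stability of $A_C$ is not assumed. *)

(* Defs.v *)
From HB Require Import structures.
From mathcomp Require Import all_boot all_order all_algebra.
From mathcomp Require Export complex.
From mathcomp Require Export reals.

Set Implicit Arguments.
Unset Strict Implicit.
Unset Printing Implicit Defensive.

Import Order.TTheory GRing.Theory Num.Theory.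
Local Open Scope ring_scope.

(* The same shape as [companionmx] of mxpoly, but of size [n] on the nose rather
   than of size [(size p).-1] for a coefficient sequence [p]. *)
Definition companion (R : nzRingType) (n : nat) (a : 'rV[R]_n) : 'M[R]_n :=
  \matrix_(i, j) if i.+1 == n then - a 0 j else (i.+1 == j)%:R.

Definition e_last (R : nzRingType) (n : nat) : 'cV[R]_n :=
  \col_i (i.+1 == n)%:R.
Arguments e_last R n : clear implicits.

(* diag(-1, (-1)^2, ..., (-1)^n): the 0-based index [i] carries (-1)^(i+1). *)
Definition signJ (R : nzRingType) (n : nat) : 'M[R]_n :=
  diag_mx (\row_i (-1) ^+ i.+1).
Arguments signJ R n : clear implicits.

(* Upper Jordan block, so that A X = X J says (A - lam I) x_1 = 0 and
   (A - lam I) x_k = x_(k-1) for the columns x_k of X. *)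
Definition jordan_block (R : nzRingType) (p : nat) (lam : R) : 'M[R]_p :=
  \matrix_(k, l) ((k == l)%:R * lam + (k.+1 == l :> nat)%:R).
Arguments jordan_block {R} p lam.

Definition lyapunov_sol (R : nzRingType) (n : nat) (A P : 'M[R]_n) : Prop :=
  A *m P + P *m A^T = - (e_last R n *m (e_last R n)^T).

(* The entry of [v] at the 0-based index [r], and 0 when [r] is out of range. *)
Definition row_nth (R : nzRingType) (p : nat) (v : 'rV[R]_p) (r : nat) : R :=
  if insub r is Some i then v 0 i else 0.

(* With 0-based indices the entries t_(k-l+1) and h_(k+l-1) become
   [row_nth t (k - l)] and [row_nth h (k + l)]. *)
Definition lower_toeplitz (R : nzRingType) (p : nat) (t : 'rV[R]_p) : 'M[R]_p :=
  \matrix_(k, l) if (l <= k)%N then row_nth t (k - l) else 0.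

Definition upper_hankel (R : nzRingType) (p : nat) (h : 'rV[R]_p) : 'M[R]_p :=
  \matrix_(k, l) if (k + l < p)%N then row_nth h (k + l) else 0.

Definition c_row (R : nzRingType) (n : nat) (a : 'rV[R]_n) : 'rV[R]_n :=
  a *m (((-1) ^+ n)%:M + signJ R n).

(* [X] is the n x p matrix of right generalized eigenvectors x_1, ..., x_p (as
   columns); c^T X is the row of the c^T x_k. *)
Definition Tmx (R : nzRingType) (n p : nat) (a : 'rV[R]_n) (X : 'M[R]_(n, p)) :
    'M[R]_p :=
  lower_toeplitz (c_row a *m X).

(* [Y] is the p x n matrix of left generalized eigenvectors y_1, ..., y_p (as
   rows); e_n^T Y^T is the row of the e_n^T y_l. *)
Definition Hmx (R : nzRingType) (n p : nat) (Y : 'M[R]_(p, n)) : 'M[R]_p :=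
  upper_hankel ((e_last R n)^T *m Y^T).

Definition Phat (R : comUnitRingType) (n p : nat) (a : 'rV[R]_n)
    (X : 'M[R]_(n, p)) (Y : 'M[R]_(p, n)) : 'M[R]_n :=
  X *m Hmx Y *m invmx (Tmx a X) *m X^T *m signJ R n.

Definition Phat_inv (R : comUnitRingType) (n p : nat) (a : 'rV[R]_n)
    (X : 'M[R]_(n, p)) (Y : 'M[R]_(p, n)) : 'M[R]_n :=
  signJ R n *m Y^T *m Tmx a X *m invmx (Hmx Y) *m Y.

Definition toC (R : realType) (m n : nat) (A : 'M[R]_(m, n)) : 'M[R[i]]_(m, n) :=
  map_mx (fun x : R => (x%:C)%C) A.

(* Main.v *)
Require Import Defs.
From HB Require Import structures.
From mathcomp Require Import all_boot all_order all_algebra.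
From mathcomp Require Import perm complex reals.

Set Implicit Arguments.
Unset Strict Implicit.
Unset Printing Implicit Defensive.

Import Order.TTheory GRing.Theory Num.Theory.
Local Open Scope ring_scope.

(** Write A for the companion matrix, e for the last basis vector, J for the
    sign matrix (so J^2 = 1) and c for the row of the statement, taken below as
    a column.  Conjugating a companion matrix by J gives minus a companion
    matrix, whence (companion_signJ)

      A + J A J = - (-1)^n e c^T.

    With the unknown P = S J, the Lyapunov equation A P + P A^T = - e e^T
    becomes A S - S A^T = (-1)^n (S c - e) e^T.  It therefore suffices to find S
    with A S = S A^T and S c = e (lyapunov_of_intertwine), and this can be done
    one Jordan block at a time: S_i = M_i H_i T_i^-1 M_i^T works because
    - A M_i = M_i J_i with J_i the Jordan block, J_i H_i = H_i J_i^T for every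
      upper Hankel matrix, and J_i^T commutes with every lower Toeplitz matrix,
      so that A S_i = S_i A^T (Shat_intertwine);
    - the first column of T_i is M_i^T c and that of H_i is Minv_i e, so that
      S_i c = M_i Minv_i e, and these vectors add up to e (Shat_c_row).

    The matrices T_i and H_i are triangular up to a permutation of rows, with a
    constant diagonal.  The diagonal entry of H_i is the last entry of a left
    eigenvector of A, which cannot vanish for a companion matrix
    (companion_left_eigen0).  That of T_i is c^T x_1, with x_1 an eigenvector for
    lam_i; if it vanished then J x_1 would be an eigenvector for - lam_i by the
    displayed identity (companion_right_eigen), and the assumption on the sums
    lam_i + lam_j forbids this.

    The products of the P_i and Q_j collapse by J^2 = 1 and by the
    biorthogonality Minv_i M_j = delta_ij, which also shows that the sum of the
    Q_j inverts the sum of the P_i.  The solution is unique because A and - A^T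
    have no common eigenvalue: by Cayley-Hamilton and a Bezout relation between
    the two characteristic polynomials, A X = X B then forces X = 0
    (sylvester_eq0).  Uniqueness over the complex numbers makes the solution
    invariant under conjugation, hence real. *)

(** * Structured matrices attached to one Jordan block *)

Lemma sum_ord_delta (R : nzRingType) (p s : nat) (f : nat -> R) :
  \sum_(l < p) f l * (s == l :> nat)%:R = if (s < p)%N then f s else 0.
Proof.
case: ltnP => [lt_sp | le_ps].
  rewrite (bigD1 (Ordinal lt_sp)) //= eqxx mulr1 big1 ?addr0 // => l ne_ls.
  by rewrite eq_sym (negPf (ne_ls : l != s :> nat)) mulr0.
rewrite big1 // => l _; rewrite gtn_eqF ?mulr0 //.
exact: leq_trans (ltn_ord l) le_ps.
Qed.

Lemma row_nth_ord (R : nzRingType) (p : nat) (v : 'rV[R]_p) (i : 'I_p) :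
  row_nth v i = v 0 i.
Proof. by rewrite /row_nth valK. Qed.

Definition shiftmx (R : nzRingType) (p : nat) : 'M[R]_p :=
  \matrix_(k, l) (k.+1 == l :> nat)%:R.

Lemma jordan_blockE (R : nzRingType) (p : nat) (z : R) :
  jordan_block p z = z%:M + shiftmx R p.
Proof. by apply/matrixP => k l; rewrite !mxE mulr_natl. Qed.

(** Entry (k, l) of a lower Toeplitz matrix depends on k - l only, so moving the
    rows down is the same as moving the columns to the left. *)
Lemma shiftmx_tr_toeplitz (R : comNzRingType) (p : nat) (t : 'rV[R]_p) :
  (shiftmx R p)^T *m lower_toeplitz t = lower_toeplitz t *m (shiftmx R p)^T.
Proof.
apply/matrixP => k l; rewrite !mxE.
pose f i j := if (j <= i)%N then row_nth t (i - j) else 0.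
transitivity (\sum_(j < p) f k j * (l.+1 == j :> nat)%:R); last first.
  by apply: eq_bigr => j _; rewrite !mxE.
transitivity (\sum_(j < p) (0 < k)%:R * (f j l * (k.-1 == j :> nat)%:R)).
  apply: eq_bigr => j _; rewrite !mxE mulrC.
  by case: (nat_of_ord k) => [|k'] /=; rewrite ?mulr0 ?mul0r // mul1r eqSS eq_sym.
rewrite -big_distrr /= (sum_ord_delta _ _ (fun j => f j l)) sum_ord_delta.
rewrite (leq_ltn_trans (leq_pred k) (ltn_ord k)) /f.
case: (posnP k) => [-> | k_gt0]; first by rewrite mul0r if_same.
rewrite mul1r -ltnS prednK //; case: ltnP => [lt_lk | _]; last by rewrite if_same.
by rewrite (leq_ltn_trans lt_lk) // -subn1 -subnDA add1n.
Qed.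

(** Entry (k, l) of an upper Hankel matrix depends on k + l only, so moving the
    rows up is the same as moving the columns to the left. *)
Lemma shiftmx_hankel (R : comNzRingType) (p : nat) (h : 'rV[R]_p) :
  shiftmx R p *m upper_hankel h = upper_hankel h *m (shiftmx R p)^T.
Proof.
apply/matrixP => k l; rewrite !mxE.
pose f i j := if (i + j < p)%N then row_nth h (i + j) else 0.
transitivity (\sum_(j < p) f j l * (k.+1 == j :> nat)%:R).
  by apply: eq_bigr => j _; rewrite !mxE mulrC.
transitivity (\sum_(j < p) f k j * (l.+1 == j :> nat)%:R); last first.
  by apply: eq_bigr => j _; rewrite !mxE.
rewrite (sum_ord_delta _ _ (fun j => f j l)) sum_ord_delta /f addSnnS.
case: (ltnP (k + l.+1) p) => [lt_klp | _]; last by rewrite !if_same.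
have lt_kp : (k.+1 < p)%N by rewrite (leq_ltn_trans _ lt_klp) // -addSnnS leq_addr.
have lt_lp : (l.+1 < p)%N by rewrite (leq_ltn_trans _ lt_klp) // leq_addl.
by rewrite lt_kp lt_lp.
Qed.

Lemma jordan_block_tr_toeplitz (R : comNzRingType) (p : nat) (z : R)
    (t : 'rV[R]_p) :
  (jordan_block p z)^T *m lower_toeplitz t =
    lower_toeplitz t *m (jordan_block p z)^T.
Proof.
rewrite jordan_blockE linearD /= tr_scalar_mx mulmxDl mulmxDr scalar_mxC.
by rewrite shiftmx_tr_toeplitz.
Qed.

Lemma jordan_block_hankel (R : comNzRingType) (p : nat) (z : R) (h : 'rV[R]_p) :
  jordan_block p z *m upper_hankel h = upper_hankel h *m (jordan_block p z)^T.
Proof.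
rewrite jordan_blockE linearD /= tr_scalar_mx mulmxDl mulmxDr scalar_mxC.
by rewrite shiftmx_hankel.
Qed.

(** Zero-based, and defined in every dimension, including 0: a block size is an
    arbitrary natural number. *)
Definition e_first (R : nzRingType) (p : nat) : 'cV[R]_p :=
  \col_k (0 == k :> nat)%:R.

Lemma toeplitz_e_first (R : nzRingType) (p : nat) (t : 'rV[R]_p) :
  lower_toeplitz t *m e_first R p = t^T.
Proof.
apply/matrixP => k j; rewrite ord1 !mxE.
transitivity (\sum_(l < p) row_nth t (k - l) * (0 == l :> nat)%:R).
  by apply: eq_bigr => -[[|l] ltl] _; rewrite !mxE //= !mulr0.
rewrite (sum_ord_delta _ _ (fun l => row_nth t (k - l))) subn0 row_nth_ord.
by rewrite (leq_ltn_trans (leq0n k)).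
Qed.

Lemma hankel_e_first (R : nzRingType) (p : nat) (h : 'rV[R]_p) :
  upper_hankel h *m e_first R p = h^T.
Proof.
apply/matrixP => k j; rewrite ord1 !mxE.
transitivity (\sum_(l < p) row_nth h (k + l) * (0 == l :> nat)%:R).
  by apply: eq_bigr => -[[|l] ltl] _; rewrite !mxE /= ?mulr0 // addn0 ltn_ord.
rewrite (sum_ord_delta _ _ (fun l => row_nth h (k + l))) addn0 row_nth_ord.
by rewrite (leq_ltn_trans (leq0n k)).
Qed.

(** The condition on [t] is put under a quantifier over ['I_p] because [t] has
    no entry at index 0 when [p] is 0. *)
Lemma toeplitz_unit (F : fieldType) (p : nat) (t : 'rV[F]_p) :
  (forall k : 'I_p, k = 0 :> nat -> t 0 k != 0) -> lower_toeplitz t \in unitmx.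
Proof.
move=> t0_neq0; rewrite unitmxE unitfE det_trig; last first.
  by apply/is_trig_mxP => k l lt_kl; rewrite mxE leqNgt lt_kl.
apply/prodf_neq0 => k _; rewrite mxE leqnn subnn.
have p_gt0 : (0 < p)%N := leq_ltn_trans (leq0n k) (ltn_ord k).
by rewrite (row_nth_ord t (Ordinal p_gt0)) t0_neq0.
Qed.

(** Reversing the order of the rows turns an upper Hankel matrix into a lower
    Toeplitz one, with the last entry of [h] on its diagonal. *)
Lemma hankel_unit (F : fieldType) (p : nat) (h : 'rV[F]_p) :
  (forall k : 'I_p, k.+1 = p :> nat -> h 0 k != 0) -> upper_hankel h \in unitmx.
Proof.
move=> hp_neq0; pose s := perm (@rev_ord_inj p).
have : row_perm s (upper_hankel h) = lower_toeplitz (\row_k h 0 (rev_ord k)).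
  apply/matrixP => k l; rewrite !mxE permE /=.
  have [le_lk | lt_kl] := leqP l k; last first.
    by rewrite ltnNge -[leqLHS](subnK (ltn_ord k)) leq_add2l lt_kl.
  have lt_klp : (k - l < p)%N := leq_ltn_trans (leq_subr l k) (ltn_ord k).
  rewrite (row_nth_ord _ (Ordinal lt_klp)) mxE -row_nth_ord /=.
  have -> : (p - k.+1 + l)%N = (p - (k - l).+1)%N.
    by rewrite -subSn // subnBA ?leqW // addnBAC.
  by rewrite ltn_subrL /= (leq_ltn_trans (leq0n k)).
rewrite row_permE => hankelE.
have : lower_toeplitz (\row_k h 0 (rev_ord k)) \in unitmx.
  apply: toeplitz_unit => k k0; rewrite mxE hp_neq0 //= k0 subn1 prednK //.
  exact: leq_ltn_trans (leq0n k) (ltn_ord k).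
by rewrite -hankelE unitmx_mul => /andP[].
Qed.

Lemma jordan_block_unit (F : fieldType) (p : nat) (z : F) :
  z != 0 -> jordan_block p z \in unitmx.
Proof.
move=> z_neq0; rewrite -unitmx_tr unitmxE unitfE det_trig.
  apply/prodf_neq0 => k _.
  by rewrite !mxE eqxx mul1r (gtn_eqF (ltnSn k)) addr0.
apply/is_trig_mxP => k l lt_kl.
by rewrite !mxE -val_eqE /= (gtn_eqF (leqW lt_kl)) (gtn_eqF lt_kl) mul0r addr0.
Qed.

Lemma jordan_block_eigen0 (F : fieldType) (p : nat) (z z' : F) (w : 'rV[F]_p) :
  w *m jordan_block p z = z' *: w -> z' != z -> w = 0.
Proof.
move=> wJ ne_zz'.
have unitJ : jordan_block p (z - z') \in unitmx.
  by rewrite jordan_block_unit // subr_eq0 eq_sym.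
rewrite -[w](mulmxK unitJ) -[RHS](mul0mx _ (invmx (jordan_block p (z - z')))).
congr (_ *m _); rewrite jordan_blockE raddfB /= addrAC -jordan_blockE mulmxBr wJ.
by rewrite mul_mx_scalar subrr.
Qed.

(** * Two facts of linear algebra *)

Lemma eigenvalue_tr (F : fieldType) (n : nat) (A : 'M[F]_n) (z : F) :
  eigenvalue A^T z = eigenvalue A z.
Proof.
rewrite /eigenvalue /eigenspace !kermx_eq0 !row_free_unit -(unitmx_tr (A - _)).
by rewrite linearB /= tr_scalar_mx.
Qed.

Lemma eigenvalue_right (F : fieldType) (n : nat) (A : 'M[F]_n) (z : F)
    (x : 'cV[F]_n) :
  A *m x = z *: x -> x != 0 -> eigenvalue A z.
Proof.
move=> Ax x_neq0; rewrite -eigenvalue_tr; apply/eigenvalueP; exists x^T.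
  by rewrite -trmx_mul Ax linearZ.
by rewrite -(inj_eq trmx_inj) trmxK trmx0.
Qed.

Lemma horner_mx_intertwine (R : comNzRingType) (n : nat) (A B X : 'M[R]_n.+1)
    (q : {poly R}) :
  A *m X = X *m B -> horner_mx A q *m X = X *m horner_mx B q.
Proof.
move=> AX; elim/poly_ind: q => [|q c IHq]; first by rewrite !rmorph0 mul0mx mulmx0.
rewrite !rmorphD !rmorphM /= !horner_mx_X !horner_mx_C mulmxDl mulmxDr.
by rewrite scalar_mxC -!mulmxE -mulmxA AX !mulmxA IHq.
Qed.

(** The equation gives q(A) X = X q(B) for every polynomial q.  For q the
    characteristic polynomial of A the left side is 0 by Cayley-Hamilton, while
    q(B) is invertible: q is prime to the characteristic polynomial of B, which
    kills B. *)
Lemma sylvester_eq0 (F : closedFieldType) (n : nat) (A B X : 'M[F]_n) :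
  (forall z, eigenvalue A z -> ~~ eigenvalue B z) -> A *m X = X *m B -> X = 0.
Proof.
case: n A B X => [|n] A B X specAB AX; first by apply/matrixP => -[].
have /Bezout_eq1_coprimepP [[u v] /= uv1] :
    coprimep (char_poly A) (char_poly B).
  apply/Pdiv.ClosedField.coprimepP => z.
  by rewrite -eigenvalue_root_char => /specAB; rewrite eigenvalue_root_char.
have XpB : X *m horner_mx B (char_poly A) = 0.
  by rewrite -(horner_mx_intertwine _ AX) Cayley_Hamilton mul0mx.
have := congr1 (horner_mx B) uv1; rewrite mulrC.
rewrite rmorphD !rmorphM rmorph1 /= Cayley_Hamilton mulr0 addr0 => pBu.
by rewrite -[X]mulmx1 -[1%:M]pBu mulmxA XpB mul0mx.
Qed.

(** * Companion matrices *)

Lemma signJ_sqr (R : nzRingType) (n : nat) : signJ R n *m signJ R n = 1%:M.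
Proof.
apply/matrixP => i j; rewrite mul_diag_mx !mxE; case: eqVneq => [->|_].
  by rewrite -expr2 sqrr_sign.
by rewrite mulr0.
Qed.

Lemma signJ_tr (R : nzRingType) (n : nat) : (signJ R n)^T = signJ R n.
Proof. exact: tr_diag_mx. Qed.

Lemma signJ_e_last (R : comNzRingType) (n : nat) :
  signJ R n *m e_last R n = (-1) ^+ n *: e_last R n.
Proof.
apply/matrixP => i j; rewrite mul_diag_mx !mxE.
by case: eqP => [->|_]; rewrite ?mulr0.
Qed.

Lemma c_rowE (R : comNzRingType) (n : nat) (a : 'rV[R]_n) (j : 'I_n) :
  c_row a 0 j = a 0 j * ((-1) ^+ n + (-1) ^+ j.+1).
Proof.
by rewrite /c_row mulmxDr mul_mx_scalar mul_mx_diag !mxE mulrDr mulrC.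
Qed.

(** Conjugation by J negates the superdiagonal of ones, so only the last row of
    the two sides can contribute the rank-one term; there the entries of [a]
    add up where the signs agree and cancel elsewhere, which is what [c_row]
    records. *)
Lemma companion_signJ (R : comNzRingType) (n : nat) (a : 'rV[R]_n) :
  signJ R n *m companion a *m signJ R n =
    - companion a - (-1) ^+ n *: (e_last R n *m c_row a).
Proof.
have sqr_sign k : (-1) ^+ k * (-1) ^+ k = 1 :> R.
  by rewrite -expr2 sqrr_sign.
apply/matrixP => i j; rewrite mul_mx_diag mul_diag_mx !mxE big_ord1 c_rowE !mxE.
case: eqP => [->|_].
  rewrite mul1r !mulrDr (mulrCA _ _ ((-1) ^+ n)) sqr_sign mulr1 opprK opprD.
  by rewrite addrA subrr add0r mulrN mulNr mulrA.
rewrite mul0r mulr0 subr0; case: eqP => [->|_]; last by rewrite mulr0 mul0r oppr0.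
by rewrite mulr1 exprS mulN1r mulrN sqr_sign.
Qed.

(** This is the controllability of the pair formed by a companion matrix and the
    last basis vector, in eigenvector form: when the last entry of [y] vanishes,
    the eigenvector equation reads y_k = z y_(k+1), so every entry vanishes. *)
Lemma companion_left_eigen0 (R : comNzRingType) (n : nat) (a y : 'rV[R]_n)
    (z : R) :
  y *m companion a = z *: y -> y *m e_last R n = 0 -> y = 0.
Proof.
move=> yA ye; apply/rowP => k; rewrite mxE.
have y_last (i : 'I_n) : i.+1 = n -> y 0 i = 0.
  move=> i_last; have /matrixP/(_ 0 0) := ye; rewrite !mxE (bigD1 i) //= big1.
    by rewrite !mxE i_last eqxx mulr1 addr0.
  move=> l ne_li; rewrite mxE; case: eqP => [l_last|_]; last by rewrite mulr0.
  by case/eqP: ne_li; apply: val_inj; apply: succn_inj; rewrite l_last.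
(* Descending induction on the index. *)
have [d] := ubnP (n - k)%N; elim: d k => // d IHd k; rewrite ltnS => le_nkd.
have [lt_kn | ge_kn] := ltnP k.+1 n; last first.
  by apply: y_last; apply/eqP; rewrite eqn_leq ge_kn ltn_ord.
have /rowP/(_ (Ordinal lt_kn)) := yA; rewrite !mxE [in RHS]IHd; last first.
  by rewrite (leq_trans _ le_nkd) // subnS prednK // subn_gt0.
rewrite mulr0 (bigD1 k) //= big1 ?addr0 => [|l ne_lk].
  by rewrite mxE /= (ltn_eqF lt_kn) eqxx mulr1.
rewrite mxE /=; case: eqP => [/y_last->|_]; first by rewrite mul0r.
by rewrite eqSS (negPf (ne_lk : l != k :> nat)) mulr0.
Qed.

(** By [companion_signJ], an eigenvector killed by [c_row a] satisfies
    J A J x = - A x, so J x is an eigenvector for the opposite eigenvalue. *)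
Lemma companion_right_eigen (F : fieldType) (n : nat) (a : 'rV[F]_n) (z : F)
    (x : 'cV[F]_n) :
  companion a *m x = z *: x -> x != 0 -> c_row a *m x = 0 ->
  eigenvalue (companion a) (- z).
Proof.
move=> Ax x_neq0 cx; apply: (@eigenvalue_right _ _ _ _ (signJ F n *m x)); last first.
  apply: contra_neq x_neq0 => Jx.
  by rewrite -[x]mul1mx -(signJ_sqr F n) -mulmxA Jx mulmx0.
rewrite -[LHS]mul1mx -(signJ_sqr F n) -!mulmxA.
rewrite [X in _ *m X = _](_ : _ = - z *: x); first by rewrite scalemxAr.
rewrite !mulmxA companion_signJ mulmxBl mulNmx Ax -scalemxAl -mulmxA cx mulmx0.
by rewrite scaler0 subr0 scaleNr.
Qed.

(** * The contribution of one Jordan block *)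

(** The diagonal of [Tmx a X] is c^T x_1, with x_1 the first column of [X], which
    is an eigenvector. *)
Lemma Tmx_unit (F : fieldType) (n p : nat) (a : 'rV[F]_n) (z : F)
    (X : 'M[F]_(n, p)) (Y : 'M[F]_(p, n)) :
  companion a *m X = X *m jordan_block p z -> Y *m X = 1%:M ->
  ~~ eigenvalue (companion a) (- z) -> Tmx a X \in unitmx.
Proof.
move=> AX YX no_eigen; apply: toeplitz_unit => k k0.
apply: contraNneq no_eigen => cXk.
apply: (@companion_right_eigen _ _ _ _ (col k X)).
- rewrite !colE mulmxA AX -mulmxA scalemxAr; congr (_ *m _).
  apply/matrixP => l j; rewrite -colE ord1 !mxE k0 addr0 andbT mulrC.
  by [].
(* A vanishing column of X would contradict Y X = 1. *)
- apply: contra_eq_neq YX => Xk; apply/eqP => /(congr1 (col k)).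
  rewrite !colE -mulmxA -colE Xk mulmx0 mul1mx => /matrixP/(_ k 0)/eqP.
  by rewrite !mxE !eqxx eq_sym oner_eq0.
- apply/matrixP => i j; rewrite !ord1 colE mulmxA -colE !mxE -[RHS]cXk.
  by rewrite !mxE.
Qed.

(** The antidiagonal of [Hmx Y] is the last entry of the last row of [Y], which is
    a left eigenvector. *)
Lemma Hmx_unit (F : fieldType) (n p : nat) (a : 'rV[F]_n) (z : F)
    (X : 'M[F]_(n, p)) (Y : 'M[F]_(p, n)) :
  Y *m companion a = jordan_block p z *m Y -> Y *m X = 1%:M ->
  Hmx Y \in unitmx.
Proof.
move=> YA YX; apply: hankel_unit => k k_last; apply/eqP.
rewrite -trmx_mul mxE => Yek.
have Yk : row k Y = 0.
  apply: (@companion_left_eigen0 _ _ a _ z).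
    rewrite -row_mul YA rowE mulmxA.
    rewrite [_ *m jordan_block p z](_ : _ = z *: delta_mx 0 k).
      by rewrite -scalemxAl -rowE.
    apply/rowP => l; rewrite -rowE !mxE k_last (gtn_eqF (ltn_ord l)) addr0 mulrC.
    by rewrite eq_sym.
  by apply/matrixP => i j; rewrite !ord1 -row_mul [LHS]mxE Yek mxE.
have /rowP/(_ k)/eqP := congr1 (row k) YX.
by rewrite row_mul Yk mul0mx !mxE eqxx eq_sym oner_eq0.
Qed.

(** [Phat] without its trailing sign matrix.  The sum of these over the blocks is
    the matrix that intertwines the companion matrix with its transpose. *)
Definition Shat (F : comUnitRingType) (n p : nat) (a : 'rV[F]_n)
    (X : 'M[F]_(n, p)) (Y : 'M[F]_(p, n)) : 'M[F]_n :=
  X *m Hmx Y *m invmx (Tmx a X) *m X^T.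

Lemma Shat_intertwine (F : comUnitRingType) (n p : nat) (a : 'rV[F]_n) (z : F)
    (X : 'M[F]_(n, p)) (Y : 'M[F]_(p, n)) :
  Tmx a X \in unitmx -> companion a *m X = X *m jordan_block p z ->
  companion a *m Shat a X Y = Shat a X Y *m (companion a)^T.
Proof.
move=> unitT AX; rewrite /Shat !mulmxA AX -!mulmxA -trmx_mul AX trmx_mul.
congr (_ *m _); rewrite !mulmxA; congr (_ *m _).
rewrite jordan_block_hankel -!mulmxA; congr (_ *m _).
apply: (canRL (mulKmx unitT)).
by rewrite mulmxA -jordan_block_tr_toeplitz mulmxK.
Qed.

Lemma Shat_c_row (F : comUnitRingType) (n p : nat) (a : 'rV[F]_n)
    (X : 'M[F]_(n, p)) (Y : 'M[F]_(p, n)) :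
  Tmx a X \in unitmx -> Shat a X Y *m (c_row a)^T = X *m Y *m e_last F n.
Proof.
move=> unitT; rewrite /Shat -!mulmxA -trmx_mul -toeplitz_e_first mulKmx //.
by rewrite hankel_e_first trmx_mul !trmxK.
Qed.

Lemma Phat_mul_inv (F : comUnitRingType) (n p : nat) (a : 'rV[F]_n)
    (X : 'M[F]_(n, p)) (Y : 'M[F]_(p, n)) :
  Y *m X = 1%:M -> Tmx a X \in unitmx -> Hmx Y \in unitmx ->
  Phat a X Y *m Phat_inv a X Y = X *m Y.
Proof.
move=> YX unitT unitH; rewrite /Phat /Phat_inv -!mulmxA.
rewrite (mulmxA (signJ F n) (signJ F n)) signJ_sqr mul1mx (mulmxA X^T) -trmx_mul YX trmx1.
by rewrite mul1mx mulKmx // mulKVmx.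
Qed.

Lemma Phat_mul_inv0 (F : comUnitRingType) (n p q : nat) (a : 'rV[F]_n)
    (X : 'M[F]_(n, p)) (Y : 'M[F]_(p, n)) (X' : 'M[F]_(n, q)) (Y' : 'M[F]_(q, n)) :
  Y' *m X = 0 -> Phat a X Y *m Phat_inv a X' Y' = 0.
Proof.
move=> YX; rewrite /Phat /Phat_inv -!mulmxA (mulmxA (signJ F n) (signJ F n)) signJ_sqr.
by rewrite mul1mx (mulmxA X^T) -trmx_mul YX trmx0 mul0mx !mulmx0.
Qed.

(** * The Lyapunov equation *)

(** [companion_signJ] lets the sign matrix pass through the transposed companion
    matrix, at the cost of a rank-one term that the second hypothesis turns into
    the right-hand side of the equation. *)
Lemma lyapunov_of_intertwine (R : comNzRingType) (n : nat) (a : 'rV[R]_n)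
    (S : 'M[R]_n) :
  companion a *m S = S *m (companion a)^T -> S *m (c_row a)^T = e_last R n ->
  lyapunov_sol (companion a) (S *m signJ R n).
Proof.
move=> AS Sc; rewrite /lyapunov_sol mulmxA AS.
have JA : signJ R n *m (companion a)^T =
    - ((companion a)^T *m signJ R n) - (c_row a)^T *m (e_last R n)^T.
  have := congr1 trmx (companion_signJ a).
  rewrite linearB linearN linearZ /= (trmx_mul (e_last R n)).
  rewrite (trmx_mul _ (signJ R n)) (trmx_mul (signJ R n)) !signJ_tr => JAJ.
  rewrite -[LHS]mulmx1 -(signJ_sqr R n) !mulmxA -(mulmxA (signJ R n)) JAJ.
  have eJ : (e_last R n)^T *m signJ R n = (-1) ^+ n *: (e_last R n)^T.
    by rewrite -{1}signJ_tr -trmx_mul signJ_e_last linearZ.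
  rewrite mulmxBl mulNmx -scalemxAl -mulmxA eJ -scalemxAr scalerA -expr2.
  by rewrite sqrr_sign scale1r.
by rewrite -!mulmxA JA mulmxBr mulmxN (mulmxA S (c_row a)^T) Sc addrA addrN add0r.
Qed.

Lemma lyapunov_riccati (F : comUnitRingType) (n : nat) (A P : 'M[F]_n) :
  P \in unitmx -> lyapunov_sol A P ->
  invmx P *m A + A^T *m invmx P
    = - (invmx P *m e_last F n *m (e_last F n)^T *m invmx P).
Proof.
move=> unitP solP; rewrite -(mulmxA (invmx P)) -mulNmx -mulmxN -solP.
by rewrite mulmxDr mulmxDl mulKmx // mulmxA mulmxK // addrC.
Qed.

(** The difference D of two solutions satisfies A D = D (- A^T). *)
Lemma lyapunov_unique (F : closedFieldType) (n : nat) (A P Q : 'M[F]_n) :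
  (forall z, eigenvalue A z -> ~~ eigenvalue A (- z)) ->
  lyapunov_sol A P -> lyapunov_sol A Q -> P = Q.
Proof.
move=> specA solP solQ; apply/eqP; rewrite -subr_eq0; apply/eqP.
apply: (@sylvester_eq0 _ _ A (- A^T)) => [z /specA|].
  apply: contra => /eigenvalueP[v vA v_neq0]; rewrite -eigenvalue_tr.
  apply/eigenvalueP; exists v => //.
  by rewrite scaleNr -vA mulmxN opprK.
apply/eqP; rewrite mulmxN -addr_eq0 mulmxBl mulmxBr addrACA -opprD.
by rewrite solP solQ subrr.
Qed.

(** * Assembling the blocks *)

Lemma jordan_submxrow (R : nzRingType) (n m : nat) (ns : 'I_m -> nat)
    (A : 'M[R]_n) (D : forall i, 'M[R]_(ns i)) (M : 'M[R]_(n, \sum_(i < m) ns i))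
    (Minv : 'M[R]_(\sum_(i < m) ns i, n)) (i : 'I_m) :
  Minv *m M = 1%:M -> A = M *m (\mxdiag_(i < m) D i) *m Minv ->
  A *m submxrow M i = submxrow M i *m D i.
Proof.
move=> MinvM ->; rewrite mul_submxrow -!mulmxA MinvM mulmx1.
by rewrite -[M in LHS]submxrowK mul_mxrow_mxdiag mxrowK.
Qed.

Lemma jordan_submxcol (R : nzRingType) (n m : nat) (ns : 'I_m -> nat)
    (A : 'M[R]_n) (D : forall i, 'M[R]_(ns i)) (M : 'M[R]_(n, \sum_(i < m) ns i))
    (Minv : 'M[R]_(\sum_(i < m) ns i, n)) (i : 'I_m) :
  Minv *m M = 1%:M -> A = M *m (\mxdiag_(i < m) D i) *m Minv ->
  submxcol Minv i *m A = D i *m submxcol Minv i.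
Proof.
move=> MinvM ->; rewrite submxcol_mul !mulmxA MinvM mul1mx.
by rewrite -[Minv in LHS]submxcolK mul_mxdiag_mxcol mxcolK.
Qed.

Lemma submxcol_mul_submxrow (R : nzRingType) (n m : nat) (ns : 'I_m -> nat)
    (M : 'M[R]_(n, \sum_(i < m) ns i)) (Minv : 'M[R]_(\sum_(i < m) ns i, n))
    (i : 'I_m) :
  Minv *m M = 1%:M -> submxcol Minv i *m submxrow M i = 1%:M.
Proof.
move=> MinvM; rewrite mul_submxrow submxcol_mul MinvM -submxblockEv -mxdiagZ.
exact: submxblock_diag.
Qed.

Lemma submxcol_mul_submxrow0 (R : nzRingType) (n m : nat) (ns : 'I_m -> nat)
    (M : 'M[R]_(n, \sum_(i < m) ns i)) (Minv : 'M[R]_(\sum_(i < m) ns i, n))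
    (i j : 'I_m) :
  Minv *m M = 1%:M -> i != j -> submxcol Minv i *m submxrow M j = 0.
Proof.
move=> MinvM ne_ij; rewrite mul_submxrow submxcol_mul MinvM -submxblockEv.
by rewrite -mxdiagZ mxblockK (negPf ne_ij).
Qed.

Lemma sum_submxrow_submxcol (R : nzRingType) (n m : nat) (ns : 'I_m -> nat)
    (M : 'M[R]_(n, \sum_(i < m) ns i)) (Minv : 'M[R]_(\sum_(i < m) ns i, n)) :
  M *m Minv = 1%:M -> \sum_i submxrow M i *m submxcol Minv i = 1%:M.
Proof. by rewrite -mul_mxrow_mxcol submxrowK submxcolK. Qed.

(** If [z] differs from every [lam i], each block component of an eigenvector
    vanishes, since a Jordan block has no other eigenvalue than its own. *)
Lemma jordan_spectrum (F : fieldType) (n m : nat) (ns : 'I_m -> nat)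
    (lam : 'I_m -> F) (A : 'M[F]_n) (M : 'M[F]_(n, \sum_(i < m) ns i))
    (Minv : 'M[F]_(\sum_(i < m) ns i, n)) (z : F) :
  M *m Minv = 1%:M -> Minv *m M = 1%:M ->
  A = M *m (\mxdiag_(i < m) jordan_block (ns i) (lam i)) *m Minv ->
  eigenvalue A z -> exists i, z = lam i.
Proof.
move=> MMinv MinvM defA /eigenvalueP[v vA v_neq0].
case: (pickP (fun i => z == lam i)) => [i /eqP|z_notin]; first by exists i.
case/eqP: v_neq0; rewrite -[v]mulmx1 -(sum_submxrow_submxcol MMinv) mulmx_sumr.
apply: big1 => i _; rewrite mulmxA.
rewrite (@jordan_block_eigen0 _ _ (lam i) z (v *m submxrow M i)) ?mul0mx //.
  by rewrite -mulmxA -(jordan_submxrow i MinvM defA) mulmxA vA scalemxAl.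
by rewrite z_notin.
Qed.

(** * From complex to real solutions *)

Lemma companion_toC (R : realType) (n : nat) (a : 'rV[R]_n) :
  toC (companion a) = companion (toC a).
Proof.
by apply/matrixP => i j; rewrite !mxE; case: ifP => _; rewrite ?rmorphN ?rmorph_nat.
Qed.

Lemma lyapunov_toC (R : realType) (n : nat) (A P : 'M[R]_n) :
  lyapunov_sol A P <-> lyapunov_sol (toC A) (toC P).
Proof.
have eC : toC (e_last R n) = e_last R[i] n.
  by apply/matrixP => i j; rewrite !mxE rmorph_nat.
rewrite /lyapunov_sol -eC /toC !map_trmx -!map_mxM -map_mxD -map_mxN.
by split=> [-> // | /map_mx_inj].
Qed.

Lemma conj_toC (R : realType) (n p : nat) (A : 'M[R]_(n, p)) :
  map_mx (@conjc R) (toC A) = toC A.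
Proof. by apply/matrixP => i j; rewrite !mxE conjc_real. Qed.

Lemma conj_fixed_toC (R : realType) (n p : nat) (B : 'M[R[i]]_(n, p)) :
  map_mx (@conjc R) B = B -> exists A : 'M[R]_(n, p), B = toC A.
Proof.
move=> conjB; exists (map_mx (@complex.Re R) B); apply/matrixP => i j.
have /matrixP/(_ i j) := conjB; rewrite !mxE.
case: (B i j) => x y /= [] /eqP.
by rewrite eq_sym -addr_eq0 -mulr2n mulrn_eq0 /= => /eqP->.
Qed.

Lemma lyapunov_conj (R : realType) (n : nat) (A : 'M[R]_n) (P : 'M[R[i]]_n) :
  lyapunov_sol (toC A) P -> lyapunov_sol (toC A) (map_mx (@conjc R) P).
Proof.
have eC : map_mx (@conjc R) (e_last R[i] n) = e_last R[i] n.
  by apply/matrixP => i j; rewrite !mxE rmorph_nat.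
move=> /(congr1 (map_mx (@conjc R))).
rewrite map_mxD map_mxN !map_mxM -!map_trmx conj_toC eC; exact.
Qed.

(** * The block formulas *)

Theorem theorem7 (R : realType) (n : nat) (a : 'rV[R]_n)
  (m : nat) (lam : 'I_m -> R[i]) (ns : 'I_m -> nat)
  (M : 'M[R[i]]_(n, \sum_(i < m) ns i))
  (Minv : 'M[R[i]]_(\sum_(i < m) ns i, n)) :
  let A : 'M[R]_n := companion a in
  let AC : 'M[R[i]]_n := toC A in
  let aC : 'rV[R[i]]_n := toC a in
  let M_ (i : 'I_m) : 'M[R[i]]_(n, ns i) := submxrow M i in
  let Minv_ (i : 'I_m) : 'M[R[i]]_(ns i, n) := submxcol Minv i in
  let T_ (i : 'I_m) : 'M[R[i]]_(ns i) := Tmx aC (M_ i) in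
  let H_ (i : 'I_m) : 'M[R[i]]_(ns i) := Hmx (Minv_ i) in
  let P_ (i : 'I_m) : 'M[R[i]]_n := Phat aC (M_ i) (Minv_ i) in
  let Q_ (j : 'I_m) : 'M[R[i]]_n := Phat_inv aC (M_ j) (Minv_ j) in
  (0 < n)%N ->
  injective lam ->
  (forall i, eigenvalue AC (lam i)) ->
  (forall i, mup (lam i) (char_poly AC) = ns i) ->
  (\sum_(i < m) ns i)%N = n ->
  (forall i j, lam i + lam j != 0) ->
  M *m Minv = 1%:M ->
  Minv *m M = 1%:M ->
  AC = M *m (\mxdiag_(i < m) jordan_block (ns i) (lam i)) *m Minv ->
  [/\ exists! P : 'M[R]_n, lyapunov_sol A P,
      forall i, T_ i \in unitmx /\ H_ i \in unitmx,
      forall P : 'M[R]_n, lyapunov_sol A P ->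
        [/\ P \in unitmx,
            invmx P *m A + A^T *m invmx P
              = - (invmx P *m e_last R n *m (e_last R n)^T *m invmx P),
            toC P = \sum_(i < m) P_ i
          & toC (invmx P) = \sum_(j < m) Q_ j]
    & forall i j, P_ i *m Q_ j = if i == j then M_ i *m Minv_ i else 0].
Proof.
move=> A AC aC M_ Minv_ T_ H_ P_ Q_ _ _ _ _ _ lam_sum MMinv MinvM defAC.
have AC_companion : AC = companion aC := companion_toC a.
have specAC z : eigenvalue AC z -> ~~ eigenvalue AC (- z).
  move=> /(jordan_spectrum MMinv MinvM defAC)[i ->]; apply/negP.
  case/(jordan_spectrum MMinv MinvM defAC) => j lamN.
  by have := lam_sum i j; rewrite -lamN subrr eqxx.
have AM i : companion aC *m M_ i = M_ i *m jordan_block (ns i) (lam i).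
  by rewrite -AC_companion; apply: jordan_submxrow defAC.
have MA i : Minv_ i *m companion aC = jordan_block (ns i) (lam i) *m Minv_ i.
  by rewrite -AC_companion; apply: jordan_submxcol defAC.
have MinvM_ i : Minv_ i *m M_ i = 1%:M by apply: submxcol_mul_submxrow.
have unitT i : T_ i \in unitmx.
  apply: (Tmx_unit (AM i) (MinvM_ i)); rewrite -AC_companion.
  apply/negP => /(jordan_spectrum MMinv MinvM defAC)[j lamN].
  by have := lam_sum i j; rewrite -lamN subrr eqxx.
have unitH i : H_ i \in unitmx := Hmx_unit (MA i) (MinvM_ i).
have PQ i j : P_ i *m Q_ j = if i == j then M_ i *m Minv_ i else 0.
  case: eqVneq => [<-|ne_ij]; first exact: Phat_mul_inv.
  by apply: Phat_mul_inv0; apply: submxcol_mul_submxrow0; rewrite // eq_sym.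
have solP : lyapunov_sol AC (\sum_i P_ i).
  rewrite AC_companion -mulmx_suml; apply: lyapunov_of_intertwine.
    rewrite mulmx_sumr mulmx_suml; apply: eq_bigr => i _.
    exact: Shat_intertwine (AM i).
  rewrite mulmx_suml -[RHS]mul1mx -(sum_submxrow_submxcol MMinv) mulmx_suml.
  by apply: eq_bigr => i _; apply: Shat_c_row.
have PQ1 : (\sum_i P_ i) *m (\sum_j Q_ j) = 1%:M.
  rewrite mulmx_suml -(sum_submxrow_submxcol MMinv); apply: eq_bigr => i _.
  rewrite mulmx_sumr (bigD1 i) //= PQ eqxx big1 ?addr0 // => j ne_ji.
  by rewrite PQ eq_sym (negPf ne_ji).
have uniqP (P : 'M[R]_n) : lyapunov_sol A P -> toC P = \sum_i P_ i.
  by move=> /lyapunov_toC solAP; apply: lyapunov_unique specAC solAP solP.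
split=> // [|P solAP].
  (* By uniqueness the complex solution equals its conjugate, so it is real. *)
- have [P PE] : exists P : 'M[R]_n, \sum_i P_ i = toC P.
    apply: conj_fixed_toC; apply: (lyapunov_unique specAC _ solP).
    exact: lyapunov_conj.
  exists P; split=> [|P' /uniqP]; first by apply/lyapunov_toC; rewrite -PE.
  by rewrite PE => /map_mx_inj.
- have toCP := uniqP P solAP.
  have unitP : P \in unitmx.
    by rewrite -(map_unitmx (real_complex R)) -/(toC P) toCP; case: (mulmx1_unit PQ1).
  split=> //; first exact: lyapunov_riccati.
  rewrite /toC map_invmx -/(toC P) toCP.
  have [unitSP _] := mulmx1_unit PQ1.
  by rewrite -[RHS](mulKmx unitSP) PQ1 mulmx1.
Qed.
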